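(* Let $n,k\ge1$. The torsion problem of $\mathrm{RFA}(\mathbb{Z},n,k)$ is decidable: there is an algorithm that, given a local rule of an element $T\in\mathrm{RFA}(\mathbb{Z},n,k)$, decides whether $T^m=\mathrm{id}$ for some $m\ge1$.
   Context: Let $\Sigma=\{0,\dots,n-1\}$, $Q=\{1,\dots,k\}$. Let $X_k=\{y\in\{0,1,\dots,k\}^{\mathbb{Z}} : y_{u}\ne0\text{ and }y_{v}\neq 0\implies u=v\}$ and $X_{n,k}=\Sigma^{\mathbb{Z}}\times X_k$. Given finite $F,F'\subset\mathbb{Z}$ and $f:\Sigma^F\times Q\to\Sigma^{F'}\times Q\times\mathbb{Z}$ (a local rule), the map $T_f:X_{n,k}\to X_{n,k}$ is defined by: $T_f(x,y)=(x,y)$ if $y$ is identically $0$; otherwise let $v$ be the unique position with $q=y_{v}\ne 0$, let $p\in\Sigma^F$ with $p_{u}=x_{v+u}$, and $f(p,q)=(p',q',e)$; then $T_f(x,y)=(\tilde x,\tilde y)$ with $\tilde x_{t}=p'_{t-v}$ if $t-v\in F'$, $\tilde x_{t}=x_{t}$ otherwise, and $\tilde y_{v+e}=q'$, $\tilde y_{t}=0$ for $t\ne v+e$. Such maps are the $(1,n,k)$-Turing machines; one is reversible if it has a two-sided inverse that is a $(1,n,k)$-Turing machine. $\mathrm{RFA}(\mathbb{Z},n,k)$ is the group (under composition) of reversible $(1,n,k)$-Turing machines that do not change the tape, i.e. that have a local rule $f:\Sigma^F\times Q\to\Sigma^F\times Q\times\mathbb{Z}$ of the form $f(p,q)=(p,q',z)$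 for all $p\in\Sigma^F,q\in Q$ (with $q',z$ depending on $p,q$). The torsion problem of a recursively presented group $G$ is the set of presentations of elements $g\in G$ with $g^m=1_G$ for some $m\ge1$; here elements are presented by local rules. *)

(* Defs.v *)
(* boolp is used only for the classical case distinction on whether the head is
   present, and for extracting its position. *)
From mathcomp Require Import all_boot all_order all_algebra.
From mathcomp Require Import finmap boolp.

Set Implicit Arguments.
Unset Strict Implicit.
Unset Printing Implicit Defensive.

Import GRing.Theory.

Local Open Scope ring_scope.

Definition at_most_one_head k (y : int -> 'I_k.+1) : Prop :=
  forall u v : int, y u != ord0 -> y v != ord0 -> u = v.

Definition head_shift k : Type := {y : int -> 'I_k.+1 | at_most_one_head y}.

Definition config n k : Type := ((int -> 'I_n) * head_shift k)%type.

(* Q = {1, ..., k}, as the nonzero elements of {0, ..., k}. *)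
Definition state k : finType := {q : 'I_k.+1 | q != ord0}.

Definition pattern n (F : {fset int}) : finType := {ffun F -> 'I_n}.

Definition local_rule n k (F F' : {fset int}) : Type :=
  pattern n F * state k -> pattern n F' * state k * int.

Definition single_head k (v : int) (q : state k) : int -> 'I_k.+1 :=
  fun t => if t == v then val q else ord0.

Lemma single_headP k (v : int) (q : state k) :
  at_most_one_head (single_head v q).
Proof.
rewrite /single_head => s t.
by case: (s =P v) => [->|_]; case: (t =P v) => [->|_]; rewrite ?eqxx.
Qed.
Arguments single_headP {k} v q _ _ _ _.

Definition TM_map n k (F F' : {fset int}) (f : local_rule n k F F')
    (c : config n k) : config n k :=
  let x := c.1 in let y := sval c.2 in
  match pselect (exists v, y v != ord0) with
  | right _ => c
  | left has_head =>
      let: exist v yv_neq0 := cid has_head in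
      let p := [ffun u : F => x (v + val u)] in
      let: (p', q', e) := f (p, Sub (y v) yv_neq0) in
      (fun t => if insub (t - v) is Some u then p' u else x t,
       exist _ (single_head (v + e) q') (single_headP (v + e) q'))
  end.

Definition is_TM n k (T : config n k -> config n k) : Prop :=
  exists F F' (f : local_rule n k F F'), T =1 TM_map f.

Definition reversible_TM n k (T : config n k -> config n k) : Prop :=
  is_TM T /\ exists2 S, is_TM S & cancel T S /\ cancel S T.

Definition tape_preserving n k (F : {fset int}) (f : local_rule n k F F) :
  Prop := forall p q, (f (p, q)).1.1 = p.

Definition RFA n k (T : config n k -> config n k) : Prop :=
  reversible_TM T /\
  exists F (f : local_rule n k F F), tape_preserving f /\ T =1 TM_map f.

Definition torsion (A : Type) (T : A -> A) : Prop :=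
  exists2 m : nat, (1 <= m)%N & iter m T =1 id.

(* Partial recursive functions, by arity.  In [Prec] and [Mu] the recursion,
   resp. search, variable is the first argument. *)
Inductive recfun : nat -> Type :=
| Zero : forall a, recfun a
| Succ : recfun 1
| Proj : forall a, 'I_a -> recfun a
| Comp : forall a b, recfun b -> ('I_b -> recfun a) -> recfun a
| Prec : forall a, recfun a -> recfun a.+2 -> recfun a.+1
| Mu : forall a, recfun a.+1 -> recfun a.

(* [computes c v r]: the function denoted by c is defined at v, with value r.
   In the [Prec] case h is the course of values of the recursion. *)
Fixpoint computes a (c : recfun a) : a.-tuple nat -> nat -> Prop :=
  match c in recfun a return a.-tuple nat -> nat -> Prop with
  | Zero _ => fun _ r => r = 0%N
  | Succ => fun v r => r = (thead v).+1
  | Proj _ i => fun v r => r = tnth v i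
  | Comp _ b f g => fun v r =>
      exists2 w : b.-tuple nat,
        forall i, computes (g i) v (tnth w i) & computes f w r
  | Prec _ f g => fun v r =>
      let z := [tuple of behead v] in
      exists h : nat -> nat,
        [/\ computes f z (h 0%N),
            forall i, (i < thead v)%N ->
              computes g [tuple of i :: h i :: z] (h i.+1)
          & r = h (thead v)]
  | Mu _ f => fun v r =>
      computes f [tuple of r :: v] 0%N /\
      forall i, (i < r)%N -> exists y, computes f [tuple of i :: v] y.+1
  end.

Definition code_int (z : int) : nat :=
  match z with Posz m => m.*2 | Negz m => m.*2.+1 end.

Definition code_table_row n k (F F' : {fset int}) (f : local_rule n k F F')
    (s : seq F) (s' : seq F') (pq : pattern n F * state k) : seq nat :=
  let: (p, q) := pq in
  let: (p', q', e) := f (p, q) in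
  [seq val (p u) | u <- s] ++ [:: val (val q)] ++
  [seq val (p' u) | u <- s'] ++ [:: val (val q'); code_int e].

Definition code_rule n k (F F' : {fset int}) (f : local_rule n k F F')
    (s : seq F) (s' : seq F') (args : seq (pattern n F * state k)) : nat :=
  CodeSeq.code
    (size s :: [seq code_int (val u) | u <- s] ++
     size s' :: [seq code_int (val u) | u <- s'] ++
     flatten [seq code_table_row f s s' pq | pq <- args]).

(* The number w presents f: it codes the list made of F, F' and the whole table
   of f, each listed in an arbitrary order. *)
Definition presents n k (w : nat) (F F' : {fset int})
    (f : local_rule n k F F') : Prop :=
  exists (s : seq F) (s' : seq F') (args : seq (pattern n F * state k)),
    [/\ perm_eq s (enum {: F}), perm_eq s' (enum {: F'}),
        perm_eq args (enum {: pattern n F * state k})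
      & w = code_rule f s s' args].

(* Main.v *)
(* With the tape [x] fixed, the machine acts on (position, state) pairs by an injective,
   translation-equivariant local map S_x, and it is torsion iff some positive power of all
   the S_x is the identity.  If all displacements are bounded by N, the orbits have at
   most (2N+1)k points and the machine is torsion.  Otherwise some orbit goes arbitrarily
   far; comparing the tape and the set of visited points around two cuts of that orbit and
   repeating the segment between them yields a periodic tape with period d on which some
   orbit returns to its state after moving by a nonzero multiple of d, which excludes
   torsion.  Hence torsion and its negation both have finite certificates, an exponent or
   a periodic tape with a drift, and an unbounded search finds one of them. *)
Require Import Defs.
From mathcomp Require Import all_boot all_order all_algebra.
From mathcomp Require Import finmap boolp.
From mathcomp Require Import zify.

Set Implicit Arguments.
Unset Strict Implicit.
Unset Printing Implicit Defensive.

(** * Computable functions of natural numbers *)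

(* Functions of a whole environment make shifting variables under a binder a matter of
   beta-reduction; only the first [a] values of the environment matter. *)
Definition computable a (f : (nat -> nat) -> nat) : Prop :=
  exists c : recfun a, forall v : a.-tuple nat, computes c v (f (nth 0 v)).

Lemma computable_ext a f g : f =1 g -> computable a f -> computable a g.
Proof. by move=> fg [c cP]; exists c => v; rewrite -fg. Qed.

Lemma computable_var a i : computable a (fun e => e i).
Proof.
case: (ltnP i a) => [lt_ia | le_ai].
  by exists (Proj (Ordinal lt_ia)) => v /=; rewrite (tnth_nth 0).
by exists (Zero a) => v /=; rewrite nth_default // size_tuple.
Qed.

Lemma computable_app a (F : (nat -> nat) -> nat) (gs : seq ((nat -> nat) -> nat)) :
  computable (size gs) F -> (forall i, i < size gs -> computable a (nth (fun=> 0) gs i)) ->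
  computable a (fun e => F (nth 0 [seq g e | g <- gs])).
Proof.
move=> [c cP] gsP.
have [d dP] : exists d : 'I_(size gs) -> recfun a,
    forall (i : 'I_(size gs)) (v : a.-tuple nat), computes (d i) v (nth (fun=> 0) gs i (nth 0 v)).
  exists (fun i : 'I_(size gs) => projT1 (cid (gsP i (ltn_ord i)))) => i v.
  by case: cid => d; apply.
exists (Comp c d) => v.
have szw : size [seq g (nth 0 v) | g <- gs] == size gs by rewrite size_map.
exists (Tuple szw) => [i|]; last exact: cP (Tuple szw).
by rewrite (tnth_nth 0) /= (nth_map (fun=> 0)).
Qed.

(** A tuple of length [a] reads as 0 from index [a] on. The condition on [s] keeps the variables
    that [F] must see as 0 away from the actual arguments. *)
Lemma computable_rename a b F (s : nat -> nat) :
  computable b F -> (forall i, b <= i -> a <= s i) ->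
  computable a (fun e => F (fun i => e (s i))).
Proof.
pose vars := [seq (fun e : nat -> nat => e (s i)) | i <- iota 0 b].
have szv : size vars = b by rewrite size_map size_iota.
rewrite -{1}szv => cF sP; have [i lt|c cP] := computable_app (a := a) cF.
  by rewrite (nth_map 0) ?size_iota -?szv //; apply: computable_var.
exists c => v; move: (cP v); congr (computes _ _ (F _)); apply: funext => i.
rewrite -map_comp; have [lt|ge] := ltnP i b.
  by rewrite (nth_map 0) ?size_iota // nth_iota.
by rewrite !nth_default ?size_map ?size_iota ?size_tuple // sP.
Qed.

Lemma computable_app1 a F g1 : computable 1 (fun e => F (e 0)) ->
  computable a g1 -> computable a (fun e => F (g1 e)).
Proof. by move=> cF c1; apply: (computable_app (gs := [:: g1]) cF); case. Qed.

Lemma computable_app2 a F g1 g2 : computable 2 (fun e => F (e 0) (e 1)) ->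
  computable a g1 -> computable a g2 -> computable a (fun e => F (g1 e) (g2 e)).
Proof.
by move=> cF c1 c2; apply: (computable_app (gs := [:: g1; g2]) cF); do 2?case.
Qed.

Lemma computable_app5 a F g1 g2 g3 g4 g5 :
  computable 5 (fun e => F (e 0) (e 1) (e 2) (e 3) (e 4)) ->
  computable a g1 -> computable a g2 -> computable a g3 -> computable a g4 ->
  computable a g5 ->
  computable a (fun e => F (g1 e) (g2 e) (g3 e) (g4 e) (g5 e)).
Proof.
move=> cF c1 c2 c3 c4 c5.
by apply: (computable_app (gs := [:: g1; g2; g3; g4; g5]) cF); do 5?case.
Qed.

Lemma computable_app6 a F g1 g2 g3 g4 g5 g6 :
  computable 6 (fun e => F (e 0) (e 1) (e 2) (e 3) (e 4) (e 5)) ->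
  computable a g1 -> computable a g2 -> computable a g3 -> computable a g4 ->
  computable a g5 -> computable a g6 ->
  computable a (fun e => F (g1 e) (g2 e) (g3 e) (g4 e) (g5 e) (g6 e)).
Proof.
move=> cF c1 c2 c3 c4 c5 c6.
by apply: (computable_app (gs := [:: g1; g2; g3; g4; g5; g6]) cF); do 6?case.
Qed.

Lemma computable_S a g : computable a g -> computable a (fun e => (g e).+1).
Proof.
apply: (@computable_app1 _ S); exists Succ => v /=.
by rewrite /thead (tnth_nth 0).
Qed.

Lemma computable_const a m : computable a (fun=> m).
Proof.
by elim: m => [|m IHm]; [exists (Zero a) | apply: (computable_S IHm)].
Qed.

Lemma computable_rec a (m f : (nat -> nat) -> nat) (g : nat -> nat -> (nat -> nat) -> nat) :
  computable a m -> computable a f ->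
  computable a.+2 (fun e => g (e 0) (e 1) (fun i => e i.+2)) ->
  computable a (fun e => nat_rec (fun=> nat) (f e) (fun i h => g i h e) (m e)).
Proof.
move=> cm [c cP] [d dP].
(* [Prec] recurses on its first argument, so the bound is made variable 0 here and replaced by [m]
   through a composition afterwards. *)
pose F e := nat_rec (fun=> nat) (f (fun i => e i.+1))
  (fun i h => g i h (fun i => e i.+1)) (e 0).
have cF : computable a.+1 F.
  exists (Prec c d) => v; rewrite (tuple_eta v).
  set x := thead v; set z := [tuple of behead v].
  exists (nat_rec (fun=> nat) (f (nth 0 z)) (fun i h => g i h (nth 0 z))).
  have -> : [tuple of behead [tuple of x :: z]] = z by apply: val_inj.
  split; [exact: cP | | by []].
  by move=> i _; apply: (dP [tuple of i :: _ :: z]).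
pose vars := [seq (fun e : nat -> nat => e i) | i <- iota 0 a].
have szv : size (m :: vars) = a.+1 by rewrite /= size_map size_iota.
rewrite -szv in cF.
have [i|c' c'P] := @computable_app a F (m :: vars) cF.
  rewrite szv; case: i => [|i] //= lt.
  by rewrite (nth_map 0) ?size_iota //; apply: computable_var.
exists c' => v; move: (c'P v); rewrite /F.
suff -> : (fun i => nth 0 [seq g (nth 0 v) | g <- m :: vars] i.+1) = nth 0 v by [].
apply: funext => i; rewrite /= -map_comp.
have [lt|ge] := ltnP i a; first by rewrite (nth_map 0) ?size_iota // nth_iota.
by rewrite !nth_default ?size_map ?size_iota ?size_tuple.
Qed.

Lemma computable_iter a (m f : (nat -> nat) -> nat) (g : nat -> (nat -> nat) -> nat) :
  computable a m -> computable a f ->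
  computable a.+1 (fun e => g (e 0) (fun i => e i.+1)) ->
  computable a (fun e => iter (m e) (fun h => g h e) (f e)).
Proof.
move=> cm cf cg.
have cg' : computable a.+2 (fun e => g (e 1) (fun i => e i.+2)).
  exact: (computable_rename (s := S) cg).
apply: computable_ext (computable_rec cm cf cg') => e /=.
by elim: (m e) => //= j ->.
Qed.

Lemma computable_add a g h : computable a g -> computable a h ->
  computable a (fun e => g e + h e).
Proof.
apply: (@computable_app2 _ addn).
apply: computable_ext (computable_iter (computable_var _ 0) (computable_var _ 1)
  (g := fun h _ => h.+1) (computable_S (computable_var _ 0))) => e.
by elim: (e 0) => //= j ->.
Qed.

Lemma computable_sub a g h : computable a g -> computable a h ->
  computable a (fun e => g e - h e).
Proof.
apply: (@computable_app2 _ subn).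
have c_pred b : computable b.+1 (fun e => (e 0).-1).
  apply: computable_ext (computable_rec (computable_var _ 0) (computable_const _ 0)
    (g := fun i _ _ => i) (computable_var _ 0)) => e.
  by case: (e 0).
apply: computable_ext (computable_iter (computable_var _ 1) (computable_var _ 0)
  (g := fun h _ => h.-1) (c_pred _)) => e.
by elim: (e 1) => [|j /= ->]; rewrite ?subn0 ?subnS.
Qed.

Lemma computable_mul a g h : computable a g -> computable a h ->
  computable a (fun e => g e * h e).
Proof.
apply: (@computable_app2 _ muln).
apply: computable_ext (computable_iter (computable_var _ 0) (computable_const _ 0)
  (g := fun h e => e 1 + h)
  (computable_add (computable_var _ 2) (computable_var _ 0))) => e.
by elim: (e 0) => //= j ->; rewrite mulSn.
Qed.

Lemma computable_exp a g h : computable a g -> computable a h ->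
  computable a (fun e => g e ^ h e).
Proof.
apply: (@computable_app2 _ expn).
apply: computable_ext (computable_iter (computable_var _ 1) (computable_const _ 1)
  (g := fun h e => e 0 * h)
  (computable_mul (computable_var _ 1) (computable_var _ 0))) => e.
by elim: (e 1) => //= j ->; rewrite expnS.
Qed.

Lemma computable_leq a g h : computable a g -> computable a h ->
  computable a (fun e => g e <= h e : nat).
Proof.
move=> cg ch; apply: computable_ext (computable_sub (computable_const a 1)
  (computable_sub cg ch)) => e /=.
by rewrite /leq; case: (g e - h e).
Qed.

Lemma computable_neg a (p : (nat -> nat) -> bool) :
  computable a (fun e => p e : nat) -> computable a (fun e => ~~ p e : nat).
Proof.
move=> cp; apply: computable_ext (computable_sub (computable_const a 1) cp) => e /=.
by case: (p e).
Qed.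

Lemma computable_and a (p q : (nat -> nat) -> bool) :
  computable a (fun e => p e : nat) -> computable a (fun e => q e : nat) ->
  computable a (fun e => p e && q e : nat).
Proof.
move=> cp cq; apply: computable_ext (computable_mul cp cq) => e.
exact: mulnb.
Qed.

Lemma computable_or a (p q : (nat -> nat) -> bool) :
  computable a (fun e => p e : nat) -> computable a (fun e => q e : nat) ->
  computable a (fun e => p e || q e : nat).
Proof.
move=> /computable_neg cp /computable_neg cq.
apply: computable_ext (computable_neg (computable_and cp cq)) => e.
by rewrite -negb_or negbK.
Qed.

Lemma computable_eq a g h : computable a g -> computable a h ->
  computable a (fun e => g e == h e : nat).
Proof.
move=> cg ch; apply: computable_ext (computable_and (computable_leq cg ch)
  (computable_leq ch cg)) => e.
by rewrite -eqn_leq.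
Qed.

Lemma computable_if a (p : (nat -> nat) -> bool) g h :
  computable a (fun e => p e : nat) -> computable a g -> computable a h ->
  computable a (fun e => if p e then g e else h e).
Proof.
move=> cp cg ch; apply: computable_ext (computable_add (computable_mul cp cg)
  (computable_mul (computable_neg cp) ch)) => e.
by case: (p e); rewrite mul1n mul0n ?addn0 ?add0n.
Qed.

(** The recursion carries a counter that follows the index as long as the test fails and freezes at
    the first success, after which it no longer agrees with the index. *)
Lemma computable_find a b (p : nat -> (nat -> nat) -> bool) :
  computable a b -> computable a.+1 (fun e => p (e 0) (fun i => e i.+1) : nat) ->
  computable a (fun e => find (fun j => p j e) (iota 0 (b e))).
Proof.
move=> cb cp.
have cp' : computable a.+2 (fun e => p (e 0) (fun i => e i.+2) : nat).
  (* The renaming skips the accumulator, which sits at variable 1. *)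
  by apply: (computable_rename (s := fun i => if i is j.+1 then j.+2 else 0) cp); case.
have := computable_rec cb (computable_const a 0)
  (g := fun i h e => h + ((h == i) && ~~ p i e)).
case=> [|c cP].
  apply: computable_add (computable_var _ 1) (computable_and _ (computable_neg cp')).
  exact: computable_eq (computable_var _ _) (computable_var _ _).
exists c => v; move: (cP v); congr (computes _ _ _); move: (nth 0 v) => e.
elim: (b e) => // j IHj; rewrite [LHS]/= IHj -[in RHS]addn1 iotaD add0n.
rewrite find_cat has_find size_iota.
have := find_size (p^~ e) (iota 0 j); rewrite size_iota leq_eqVlt => /orP[/eqP-> | lt].
  by rewrite ltnn eqxx /=; case: (p j e).
by rewrite lt (ltn_eqF lt) addn0.
Qed.

Lemma computable_all a b (p : nat -> (nat -> nat) -> bool) :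
  computable a b -> computable a.+1 (fun e => p (e 0) (fun i => e i.+1) : nat) ->
  computable a (fun e => all (fun j => p j e) (iota 0 (b e)) : nat).
Proof.
move=> cb /computable_neg cp; apply: computable_ext
  (computable_eq (computable_find (p := fun j e => ~~ p j e) cb cp) cb) => e.
congr nat_of_bool; rewrite -[RHS]negbK -has_predC has_find size_iota -leqNgt eqn_leq.
by have := find_size (predC (p^~ e)) (iota 0 (b e)); rewrite size_iota => ->.
Qed.

Lemma computable_has a b (p : nat -> (nat -> nat) -> bool) :
  computable a b -> computable a.+1 (fun e => p (e 0) (fun i => e i.+1) : nat) ->
  computable a (fun e => has (fun j => p j e) (iota 0 (b e)) : nat).
Proof.
move=> cb /computable_neg cp; apply: computable_ext
  (computable_neg (computable_all (p := fun j e => ~~ p j e) cb cp)) => e.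
by rewrite -has_predC; congr nat_of_bool; apply: eq_has => j /=; rewrite negbK.
Qed.

Lemma computable_divn a g h : computable a g -> computable a h ->
  computable a (fun e => g e %/ h e).
Proof.
apply: (@computable_app2 _ divn).
have := @computable_find 2 _ (fun j e => e 0 < e 1 * j.+1) (computable_var _ 0).
case=> [|c cP].
  apply: computable_leq (computable_S (computable_var _ _)) (computable_mul _ _).
    exact: computable_var.
  exact: computable_S (computable_var _ _).
(* The factor [0 < e 1] handles a zero divisor, since division by 0 yields 0. A search that fails
   below [e 0] returns [e 0], the only quotient left. *)
apply: (@computable_ext _ (fun e => (0 < e 1) * find (fun j => e 0 < e 1 * j.+1) (iota 0 (e 0)))).
  move=> e; move: (e 0) (e 1) => m [|d]; first by rewrite divn0.
  rewrite mul1n; apply/eqP; rewrite eqn_leq; apply/andP; split.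
    rewrite leqNgt; apply/negP => lt.
    have := before_find 0 lt; rewrite nth_iota ?add0n; last first.
      by apply: leq_trans lt _; rewrite -[leqRHS](size_iota 0); apply: find_size.
    by rewrite mulnC ltn_ceil.
  have := @nth_find _ 0 (fun j => m < d.+1 * j.+1) (iota 0 m).
  rewrite has_find size_iota; have [lt /(_ isT) | ge _] := ltnP.
    by rewrite nth_iota // add0n mulnC -ltn_divLR.
  by apply: leq_trans ge; apply: leq_div.
apply: computable_mul; last by exists c.
exact: computable_leq (computable_const _ _) (computable_var _ _).
Qed.

Lemma computable_modn a g h : computable a g -> computable a h ->
  computable a (fun e => g e %% h e).
Proof.
move=> cg ch; apply: computable_ext
  (computable_sub cg (computable_mul (computable_divn cg ch) ch)) => e.
by rewrite [X in X - _](divn_eq (g e) (h e)) addKn.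
Qed.

Lemma computable_dvdn a g h : computable a g -> computable a h ->
  computable a (fun e => g e %| h e : nat).
Proof.
by move=> cg ch; apply: computable_eq (computable_modn ch cg) (computable_const _ 0).
Qed.

Lemma computable_odd a g : computable a g -> computable a (fun e => odd (g e) : nat).
Proof.
move=> cg; apply: computable_ext (computable_modn cg (computable_const _ 2)) => e.
by rewrite modn2.
Qed.

Lemma computable_half a g : computable a g -> computable a (fun e => (g e)./2).
Proof.
move=> cg; apply: computable_ext (computable_divn cg (computable_const _ 2)) => e.
by rewrite divn2.
Qed.

Lemma computable_double a g : computable a g -> computable a (fun e => (g e).*2).
Proof.
by move=> cg; apply: computable_ext (computable_add cg cg) => e; rewrite addnn.
Qed.

(** * Simulation on codes *)

(** Syntax-directed on the head symbol of the body; the final [cbv beta] restores the shape that the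
    next step matches. *)
Ltac computable_step :=
  lazymatch goal with
  | |- computable _ (fun=> ?m) => apply: computable_const
  | |- computable _ (fun e => e _) => apply: computable_var
  | |- computable _ (fun e => S _) => apply: computable_S
  | |- computable _ (fun e => addn _ _) => apply: computable_add
  | |- computable _ (fun e => subn _ _) => apply: computable_sub
  | |- computable _ (fun e => muln _ _) => apply: computable_mul
  | |- computable _ (fun e => expn _ _) => apply: computable_exp
  | |- computable _ (fun e => divn _ _) => apply: computable_divn
  | |- computable _ (fun e => modn _ _) => apply: computable_modn
  | |- computable _ (fun e => double _) => apply: computable_double
  | |- computable _ (fun e => half _) => apply: computable_half
  | |- computable _ (fun e => nat_of_bool (leq _ _)) => apply: computable_leq
  | |- computable _ (fun e => nat_of_bool (odd _)) => apply: computable_odd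
  | |- computable _ (fun e => nat_of_bool (dvdn _ _)) => apply: computable_dvdn
  | |- computable _ (fun e => nat_of_bool (eq_op _ _)) => apply: computable_eq
  | |- computable _ (fun e => nat_of_bool (andb _ _)) => apply: computable_and
  | |- computable _ (fun e => nat_of_bool (orb _ _)) => apply: computable_or
  | |- computable _ (fun e => nat_of_bool (negb _)) => apply: computable_neg
  | |- computable _ (fun e => nat_of_bool (all _ _)) => apply: computable_all
  | |- computable _ (fun e => nat_of_bool (has _ _)) => apply: computable_has
  | |- computable _ (fun e => find _ _) => apply: computable_find
  | |- computable _ (fun e => iter _ _ _) => apply: computable_iter
  | |- computable _ (fun e => if _ then _ else _) => apply: computable_if
  end; cbv beta.

(* [CodeSeq.code (x :: s)] is [2 ^ x] times an odd number whose half is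
   [CodeSeq.code s]. *)
Definition code_head w := find (fun i => ~~ (2 ^ i.+1 %| w)) (iota 0 w).

Definition code_tail w := (w %/ 2 ^ code_head w)./2.

Definition code_nth w i := code_head (iter i code_tail w).

Lemma computable_code_head a g :
  computable a g -> computable a (fun e => code_head (g e)).
Proof.
apply: (@computable_app1 _ code_head); rewrite /code_head; do !computable_step.
Qed.

Lemma computable_code_tail a g :
  computable a g -> computable a (fun e => code_tail (g e)).
Proof.
apply: (@computable_app1 _ code_tail); rewrite /code_tail.
by do !first [apply: computable_code_head; cbv beta | computable_step].
Qed.

Lemma computable_code_nth a g h :
  computable a g -> computable a h -> computable a (fun e => code_nth (g e) (h e)).
Proof.
apply: (@computable_app2 _ code_nth); rewrite /code_nth.
apply/computable_code_head/(computable_iter (g := fun v _ => code_tail v)).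
- exact: computable_var.
- exact: computable_var.
- exact: computable_code_tail (computable_var _ _).
Qed.

(** The cofactor of [2 ^ x] is odd, so [2 ^ i.+1] divides the code exactly when [i < x]; as [x] is
    below the code, the bounded search reaches it. *)
Lemma code_head_cons x s : code_head (CodeSeq.code (x :: s)) = x.
Proof.
rewrite /code_head /=; set c := CodeSeq.code s; set w := _ * _.
have dvd i : (2 ^ i.+1 %| w) = (i < x).
  have [lt|ge] := ltnP i x; first by rewrite dvdn_mulr // dvdn_exp2l.
  apply/negP => /(dvdn_trans (dvdn_exp2l 2 (ge : x < i.+1))).
  by rewrite expnSr /w dvdn_pmul2l ?expn_gt0 // dvdn2 /= odd_double.
have lt_xw : x < w by rewrite /w (leq_trans (ltn_expl x (ltnSn 1))) // leq_pmulr.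
rewrite (eq_find (a2 := fun i => x <= i)); last by move=> i; rewrite dvd -leqNgt.
apply/eqP; rewrite eqn_leq; apply/andP; split.
  rewrite leqNgt; apply/negP => /(before_find 0).
  by rewrite nth_iota // leqnn.
have h : has (fun i => x <= i) (iota 0 w).
  by apply/hasP; exists x => //; rewrite mem_iota.
have := nth_find 0 h; rewrite nth_iota //.
by rewrite -[ltnRHS](size_iota 0) -has_find.
Qed.

Lemma code_tail_cons x s : code_tail (CodeSeq.code (x :: s)) = CodeSeq.code s.
Proof.
by rewrite /code_tail code_head_cons /= mulKn ?expn_gt0 //= uphalf_double.
Qed.

Lemma code_nthE s i : code_nth (CodeSeq.code s) i = nth 0 s i.
Proof.
rewrite /code_nth; elim: s i => [|x s IHs] [|i]; rewrite ?code_head_cons //.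
  (* Past the end both sides are 0: the empty list has code 0, whose head and tail are 0. *)
  by have -> : iter i.+1 code_tail (CodeSeq.code [::]) = 0 by elim: i => //= i ->.
by rewrite iterSr code_tail_cons IHs.
Qed.

(** Here [c] is the [code_int] of a displacement: an odd code [2m+1] stands for [-(m+1)], an even
    code [2m] for [m]. *)
Definition move_by p c := if odd c then p - c./2.+1 else p + c./2.

Lemma computable_move_by a g h :
  computable a g -> computable a h -> computable a (fun e => move_by (g e) (h e)).
Proof.
by apply: (@computable_app2 _ move_by); rewrite /move_by; do !computable_step.
Qed.

(** A code lists the size of [s], [s], the size of [s'], [s'], then the rows. A row holds an input
    pattern, a state, an output pattern, a new state and a displacement. This number is therefore
    the index of the new state in a row; the header is longer by one and a row by two. *)
Definition out_offset w := code_nth w 0 + code_nth w (code_nth w 0).+1 + 1.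

Definition row_offset w r := out_offset w + 1 + r * (out_offset w + 2).

Lemma computable_out_offset a g :
  computable a g -> computable a (fun e => out_offset (g e)).
Proof.
apply: (@computable_app1 _ out_offset); rewrite /out_offset.
by do !first [apply: computable_code_nth; cbv beta | computable_step].
Qed.

Lemma computable_row_offset a g h :
  computable a g -> computable a h -> computable a (fun e => row_offset (g e) (h e)).
Proof.
apply: (@computable_app2 _ row_offset); rewrite /row_offset.
by do !first [apply: computable_out_offset; cbv beta | computable_step].
Qed.

(* A tape of period [d] is given by the [d] lowest base-[n] digits of [t].  Positions are
   natural numbers, started far enough from 0 for the truncated subtraction in
   [move_by] to be exact. *)
Section Simulator.

Variables n k : nat.

Definition digit t i := t %/ n ^ i %% n.

Definition row_match w t d p q r :=
  all (fun j => code_nth w (row_offset w r + j) ==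
                digit t (move_by p (code_nth w j.+1) %% d)) (iota 0 (code_nth w 0))
  && (code_nth w (row_offset w r + code_nth w 0) == q).

(** The code of a rule has at most [w] rows, so the range is long enough. Indices past the table do
    no harm, because the first match lies inside it. *)
Definition matching_row w t d p q := row_offset w (find (row_match w t d p q) (iota 0 w)).

(** A point is packed as [position * k.+1 + state]. The output pattern is skipped, because the
    machines considered leave the tape alone. *)
Definition step w t d st :=
  move_by (st %/ k.+1)
    (code_nth w (matching_row w t d (st %/ k.+1) (st %% k.+1) + (out_offset w).+1)) * k.+1 +
  code_nth w (matching_row w t d (st %/ k.+1) (st %% k.+1) + out_offset w).

Definition run w t d s st := iter s (step w t d) st.

Definition loops_from w m p t q :=
  run w t (m.+1 * w).*2.+1 m (p * k.+1 + q.+1) == p * k.+1 + q.+1.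

(* The period exceeds the diameter of what is visible within [m] steps, so that periodic
   tapes show all local pictures. *)
Definition loops w m :=
  all (fun t => all (fun q =>
    loops_from w m ((m.+1 * w).*2.+1 + m.+1 * w) t q) (iota 0 k))
  (iota 0 (n ^ (m.+1 * w).*2.+1)).

Definition drifts_from w p t d s q :=
  [&& run w t d s (p * k.+1 + q.+1) %% k.+1 == q.+1,
      d %| run w t d s (p * k.+1 + q.+1) %/ k.+1
    & run w t d s (p * k.+1 + q.+1) %/ k.+1 != p].

(** A common bound [m] on tape, period and time lets one search variable enumerate all certificates.
    The starting position is a multiple of the period, so divisibility of the final position is
    divisibility of the displacement; it is also large enough to keep [move_by] exact for [s]
    steps. *)
Definition drifts w m :=
  has (fun t => has (fun d => has (fun s => has (fun q =>
    drifts_from w (d.+1 * (s.+1 * w)) t d.+1 s q) (iota 0 k)) (iota 0 m))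
  (iota 0 m)) (iota 0 m).

Lemma computable_row_match a g1 g2 g3 g4 g5 g6 :
  computable a g1 -> computable a g2 -> computable a g3 -> computable a g4 ->
  computable a g5 -> computable a g6 ->
  computable a (fun e => row_match (g1 e) (g2 e) (g3 e) (g4 e) (g5 e) (g6 e) : nat).
Proof.
apply: (@computable_app6 _ (fun w t d p q r => row_match w t d p q r : nat)).
rewrite /row_match /digit.
by do !first [apply: computable_code_nth; cbv beta
  | apply: computable_row_offset; cbv beta
  | apply: computable_move_by; cbv beta | computable_step].
Qed.

Lemma computable_matching_row a g1 g2 g3 g4 g5 :
  computable a g1 -> computable a g2 -> computable a g3 -> computable a g4 ->
  computable a g5 ->
  computable a (fun e => matching_row (g1 e) (g2 e) (g3 e) (g4 e) (g5 e)).
Proof.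
apply: (@computable_app5 _ matching_row); rewrite /matching_row.
by do !first [apply: computable_row_match; cbv beta
  | apply: computable_row_offset; cbv beta | computable_step].
Qed.

Lemma computable_run a g1 g2 g3 g4 g5 :
  computable a g1 -> computable a g2 -> computable a g3 -> computable a g4 ->
  computable a g5 ->
  computable a (fun e => run (g1 e) (g2 e) (g3 e) (g4 e) (g5 e)).
Proof.
apply: (@computable_app5 _ run); rewrite /run /step.
by do !first [apply: computable_matching_row; cbv beta
  | apply: computable_code_nth; cbv beta
  | apply: computable_out_offset; cbv beta
  | apply: computable_move_by; cbv beta | computable_step].
Qed.

Lemma computable_loops a g h :
  computable a g -> computable a h -> computable a (fun e => loops (g e) (h e) : nat).
Proof.
apply: (@computable_app2 _ (fun w m => loops w m : nat)); rewrite /loops /loops_from.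
by do !first [apply: computable_run; cbv beta | computable_step].
Qed.

Lemma computable_drifts a g h :
  computable a g -> computable a h -> computable a (fun e => drifts (g e) (h e) : nat).
Proof.
apply: (@computable_app2 _ (fun w m => drifts w m : nat)); rewrite /drifts /drifts_from.
by do !first [apply: computable_run; cbv beta | computable_step].
Qed.

End Simulator.

(** * Pumping walks *)

Section Walks.

Import GRing.Theory Num.Theory Order.TTheory.
Local Open Scope ring_scope.

Variables (Sig Q : finType).
Implicit Types (x y : int -> Sig) (S : (int -> Sig) -> int * Q -> int * Q).

Definition shift_point (a : int * Q) (c : int) := (a.1 + c, a.2).

(** Comparing two tapes at two positions states locality and translation equivariance at once. The
    same radius bounds the window read and the displacement. *)
Record walk R S : Prop := Walk {
  walk_local : forall x y u v q,
    (forall i : int, - R%:Z <= i <= R%:Z -> x (u + i) = y (v + i)) ->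
    S y (v, q) = shift_point (S x (u, q)) (v - u);
  walk_move : forall x a, - R%:Z <= (S x a).1 - a.1 <= R%:Z;
  walk_inj : forall x, injective (S x) }.

Definition has_drift S := exists (x : int -> Sig) (d : int) (a b : int * Q) m,
  [/\ 0 < d, forall v, x (v + d) = x v, iter m (S x) a = b,
      b.2 = a.2 /\ b.1 != a.1 & (d %| b.1 - a.1)%Z].

(** Composed with a tape, it keeps the tape before [c + d] and repeats the segment from [c] to
    [c + d] afterwards. *)
Definition fold (c d v : int) : int :=
  if v < c + d then v else c + ((v - c) %% d)%Z.

Lemma fold_eq c d v w j : 0 < d -> c <= w < c + d -> c + d <= v -> v = w + j * d ->
  fold c d v = w.
Proof.
move=> d_gt0 w_bd v_ge vE; rewrite /fold ifF ?vE; last by lia.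
have -> : w + j * d - c = j * d + (w - c) by lia.
by rewrite modzMDl modz_small; lia.
Qed.

Lemma fold_spec c d v : 0 < d -> c + d <= v ->
  exists2 j, v = fold c d v + j * d & c <= fold c d v < c + d.
Proof.
move=> d_gt0 v_ge; exists ((v - c) %/ d)%Z; rewrite /fold ifF; lia.
Qed.

(** The two arguments of [g] are equal or differ by [d], since [R < d]. If they differ, they lie
    within [R] of the cuts [c] and [c + d], where the hypothesis identifies the values. *)
Lemma fold_window (T : Type) (g : int -> T) (R : nat) (c d : int) :
  R%:Z < d ->
  (forall i : int, - R%:Z <= i <= R%:Z -> g (c + i) = g (c + d + i)) ->
  forall v i : int, - R%:Z <= i <= R%:Z -> g (fold c d v + i) = g (fold c d (v + i)).
Proof.
move=> lt_Rd gP v i i_bd; have d_gt0 : 0 < d by lia.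
have g_dn w : c + d - R%:Z <= w <= c + d + R%:Z -> g w = g (w - d).
  move=> w_bd; have -> : w - d = c + (w - d - c) by lia.
  by rewrite gP; [congr g; lia | lia].
have [vi_lt|vi_ge] := ltrP (v + i) (c + d).
  rewrite [in RHS]/fold vi_lt; have [v_lt|v_ge] := ltrP v (c + d).
    by rewrite /fold v_lt.
  rewrite (@fold_eq c d v (v - d) 1) //; try lia.
  by rewrite [RHS]g_dn; [congr g; lia | lia].
have [v_lt|v_ge] := ltrP v (c + d).
  rewrite (@fold_eq c d (v + i) (v + i - d) 1) //; try lia.
  by rewrite /fold v_lt g_dn //; lia.
have [j vE f_bd] := fold_spec d_gt0 v_ge.
have [f_lt|f_ge] := ltrP (fold c d v + i) c.
  rewrite (@fold_eq c d (v + i) (fold c d v + i + d) (j - 1)) //; try lia.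
  by rewrite [RHS]g_dn; [congr g; lia | lia].
have [f_lt'|f_ge'] := ltrP (fold c d v + i) (c + d).
  by rewrite (@fold_eq c d (v + i) (fold c d v + i) j) //; lia.
rewrite (@fold_eq c d (v + i) (fold c d v + i - d) (j + 1)) //; try lia.
by rewrite g_dn //; lia.
Qed.

Lemma fold_le c d v : 0 < d -> fold c d v <= v.
Proof.
move=> d_gt0; have [v_lt|v_ge] := ltrP v (c + d); first by rewrite /fold v_lt.
by have [_ _] := fold_spec d_gt0 v_ge; lia.
Qed.

(** Each of the finitely many elements of [l] is taken at most once. *)
Lemma injective_eventually_notin (T : eqType) (b : nat -> T) (l : seq T) :
  injective b -> exists t0, forall t, (t0 <= t)%N -> b t \notin l.
Proof.
move=> b_inj; elim: l => [|y l [t0 t0P]]; first by exists 0%N.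
have [[t1 bt1]|no_t] := pselect (exists t, b t = y); last first.
  exists t0 => t /t0P nl; rewrite inE negb_or nl andbT.
  by apply/eqP => bt; apply: no_t; exists t.
exists (maxn t0 t1.+1) => t; rewrite geq_max => /andP[/t0P nl lt1].
rewrite inE negb_or nl andbT -bt1; apply/eqP => /b_inj E.
by rewrite E ltnn in lt1.
Qed.

Lemma pigeonhole_nat (T : finType) (g : nat -> T) :
  exists i j, [/\ (i < j)%N, (j <= #|T|)%N & g i = g j].
Proof.
pose h (i : 'I_#|T|.+1) := g i.
have /injectivePn[i [j ne hE]] : ~~ injectiveb h.
  by apply/negP => /injectiveP/leq_card; rewrite card_ord ltnn.
case: (ltngtP i j) => [lt|gt|E].
- by exists i, j; split=> //; rewrite -ltnS.
- by exists j, i; split=> //; rewrite -ltnS.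
- by rewrite (val_inj E) eqxx in ne.
Qed.

Lemma iter_inj_eq (T : Type) (h : T -> T) i j a :
  injective h -> (i <= j)%N -> iter i h a = iter j h a -> a = iter (j - i) h a.
Proof.
move=> h_inj le; rewrite -{1}(subnKC le) iterD.
move: (iter (j - i) h a) => b {le}.
by elim: i => //= i IHi /h_inj.
Qed.

(* Pigeonhole on the finitely many local pictures around a cut; stopping at the first
   visit beyond [N] is what keeps the visited points from lying on a cycle. *)
Lemma similar_cuts R S :
  (forall N : nat, exists x q t, N%:Z < (iter t (S x) (0, q)).1) ->
  exists x q t (c d N : int),
  [/\ R%:Z < c, R%:Z < d, c + d + R%:Z <= N,
      N < (iter t (S x) (0, q)).1 /\
      (forall t', (t' < t)%N -> (iter t' (S x) (0, q)).1 <= N)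
    & forall i : int, - R%:Z <= i <= R%:Z -> x (c + i) = x (c + d + i) /\
      [set r | (c + i, r) \in traject (S x) (0, q) t] =
      [set r | (c + d + i, r) \in traject (S x) (0, q) t]].
Proof.
move=> far; pose prof := {ffun 'I_R.*2.+1 -> Sig * {set Q}}.
(* Room for one cut more than there are profiles, spaced by [R.+1], and for a margin of [R] beyond
   the last cut. *)
pose N := (#|{: prof}|.+2 * R.+1)%N.
have [x [q ex_t]] := far N; have [t t_far t_min] := ex_minnP ex_t. pose V := traject (S x) (0, q) t.
pose cut j : int := ((j.+1 * R.+1)%N)%:Z.
pose g j : prof := [ffun i : 'I_R.*2.+1 =>
  (x (cut j - R%:Z + i%:Z), [set r | (cut j - R%:Z + i%:Z, r) \in V])].
have [i [j [lt_ij le_j gE]]] := pigeonhole_nat g.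
exists x, q, t, (cut i), (cut j - cut i), N%:Z.
have lt_cut : ((j.+1 * R.+1)%N = i.+1 * R.+1 + (j - i).-1 * R.+1 + R.+1)%N.
  by rewrite -addnA -mulSnr -mulnDl; congr (_ * _)%N; lia.
split.
- by rewrite /cut; nia.
- rewrite /cut lt_cut !PoszD; move: (Posz (i.+1 * R.+1)) ((j - i).-1 * R.+1)%N => A B; lia.
- have -> : cut i + (cut j - cut i) = cut j by lia.
  have : (j.+1 * R.+1 <= #|{: prof}|.+1 * R.+1)%N by rewrite leq_mul.
  by rewrite /cut /N [in X in _ -> X]mulSn; lia.
- split=> // t' lt_t'; rewrite leNgt; apply/negP => /t_min.
  by rewrite leqNgt lt_t'.
move=> z z_bd; have lt_z : (absz (z + R%:Z)%R < R.*2.+1)%N by lia.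
have := congr1 (fun h : prof => h (Ordinal lt_z)) gE; rewrite !ffunE /=.
have -> : cut i + (cut j - cut i) + z = cut j - R%:Z + (absz (z + R%:Z)%R)%:Z by lia.
have -> : cut i + z = cut i - R%:Z + (absz (z + R%:Z)%R)%:Z by lia.
by case=> -> ->.
Qed.

(* The tape right of [c] is replaced by the period [x c, ..., x (c + d - 1)], and the
   visited set [V] is extended likewise to [V'].  As [V'] is invariant and misses every
   preimage of the starting point, the new orbit never closes up; being bounded on the
   left it runs to the right, where the tape is periodic. *)
Lemma pump_right R S : walk R S ->
  (forall N : nat, exists x q t, N%:Z < (iter t (S x) (0, q)).1) ->
  has_drift S.
Proof.
move=> wS /similar_cuts-/(_ R)[x [q [tau [c [d [N [c_gt d_gt N_ge [far near] sim]]]]]]].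
have d_gt0 : 0 < d by lia.
set V := traject (S x) (0, q) tau in sim.
pose x' := x \o fold c d.
have visited_fold (v i : int) : - R%:Z <= i <= R%:Z ->
    x (fold c d v + i) = x' (v + i) /\
    [set r | (fold c d v + i, r) \in V] = [set r | (fold c d (v + i), r) \in V].
  move=> i_bd; split; last first.
    by apply: (@fold_window _ (fun z => [set r | (z, r) \in V]) R) => // j /sim[].
  by apply: (@fold_window _ x R) => // j /sim[].
have fold_near (v : int) : v < c + d -> fold c d v = v by rewrite /fold => ->.
pose V' (a : int * Q) := (fold c d a.1, a.2) \in V.
have stepE v r : S x' (v, r) = shift_point (S x (fold c d v, r)) (v - fold c d v).
  by apply: (walk_local wS) => i /(visited_fold v)[].
(* Only the last visited point can leave [V]; it is not left of [c + d], because one more step, of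
   length at most [R], takes it beyond [N]. *)
have VS (a : int * Q) : a \in V -> a.1 < c + d -> S x a \in V.
  move=> /trajectP[t lt_t ->] a_lt; rewrite -iterS; apply/trajectP; exists t.+1 => //.
  rewrite ltn_neqAle lt_t andbT; apply/eqP => tE; move: far.
  rewrite -tE /=; have /andP[] := walk_move wS x (iter t (S x) (0, q)).
  by move: a_lt N_ge; move: (S x _).1 (iter _ _ _).1 => A B; lia.
have fold_lt (v : int) : fold c d v < c + d.
  have [v_lt|v_ge] := ltrP v (c + d); first by rewrite fold_near.
  by have [j _] := fold_spec d_gt0 v_ge; lia.
have V'S (a : int * Q) : V' a -> V' (S x' a).
  case: a => v r /= Va; rewrite stepE /V' /=; set b := S x _.
  have /andP[b_ge b_le] := walk_move wS x (fold c d v, r); rewrite /= -/b in b_ge b_le.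
  have i_bd : - R%:Z <= b.1 - fold c d v <= R%:Z by lia.
  have [_ /setP/(_ b.2)] := visited_fold v _ i_bd; rewrite !inE.
  have -> : fold c d v + (b.1 - fold c d v) = b.1 by lia.
  have -> : v + (b.1 - fold c d v) = b.1 + (v - fold c d v) by lia.
  by move=> <-; rewrite -surjective_pairing; apply: VS Va (fold_lt v).
have V'0 : V' (0, q).
  rewrite /V' fold_near /=; last by lia.
  apply/trajectP; exists 0%N => //; case: (tau) far => //=; lia.
(* A predecessor of the start lies within [R] of 0, hence before the seam, and is a visited point of
   the original orbit. That orbit would then be periodic, and the point beyond [N] would occur at an
   earlier time, against [near]. *)
have no_pred (a : int * Q) : V' a -> S x' a != (0, q).
  case: a => v r Va; apply/eqP => E.
  have := walk_move wS x' (v, r); rewrite E /= => v_bd.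
  have fE : fold c d v = v by apply: fold_near; lia.
  move: E Va; rewrite stepE /V' /= fE subrr /shift_point addr0 -surjective_pairing.
  move=> E /trajectP[t lt_t aE].
  have period : iter t.+1 (S x) (0, q) = (0, q) by rewrite /= -aE.
  have := near (tau - t.+1)%N; move: far; rewrite -{1}(subnK lt_t) iterD period.
  by lia.
pose b t := iter t (S x') (0, q).
have bV t : V' (b t) by elim: t => //= t; apply: V'S.
have S_inj : injective (S x') := @walk_inj _ _ wS x'.
(* Cancelling steps, a repetition would make the start a successor of a point of [V']. *)
have b_inj : injective b.
  suff b_neq i j : (i < j)%N -> b i <> b j.
    move=> i j E; case: (ltngtP i j) => // lt; first by case: (b_neq _ _ lt).
    by case: (b_neq _ _ lt).
  move=> lt E; have := iter_inj_eq S_inj (ltnW lt) E.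
  have -> : (j - i)%N = (j - i).-1.+1 by lia.
  by move=> /= E'; have := no_pred _ (bV (j - i).-1); rewrite /b -E' eqxx.
(* Folding only moves points to the left, and the folded point is visited by the original orbit
   before time [tau]. *)
have b_ge t : - (tau * R)%N%:Z <= (b t).1.
  have := fold_le c (b t).1 d_gt0; have /trajectP[l lt_l] := bV t.
  have : - (l * R)%N%:Z <= (iter l (S x) (0, q)).1.
    elim: (l) => [|l' IHl] /=; first by rewrite mul0n.
    have := walk_move wS x (iter l' (S x) (0, q)); rewrite mulSn; move: IHl.
    by move: (S x _).1 (iter _ _ _).1 (l' * R)%N => A B C; lia.
  have le_lR : (l * R <= tau * R)%N by rewrite leq_mul2r ltnW ?orbT.
  by case: (iter l _ _) => u r /= u_ge [-> _]; lia.
(* The list is the finite box of points between the left bound and [c + R]; the injective orbit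
   leaves it for good. *)
have [t0 t0P] := injective_eventually_notin
  [seq (i%:Z - (tau * R)%N%:Z, r) | i <- iota 0 (absz (c + R%:Z + (tau * R)%N%:Z)%R).+1,
                                     r <- enum Q] b_inj.
have b_far t : (t0 <= t)%N -> c + R%:Z < (b t).1.
  move=> /t0P; apply: contraNT; rewrite -leNgt => b_le.
  apply/allpairsP; exists (absz ((b t).1 + (tau * R)%N%:Z)%R, (b t).2).
  rewrite mem_iota mem_enum /=; have := b_ge t; split=> //; first by lia.
  by rewrite [LHS]surjective_pairing; congr (_, _); lia.
(* From time [t0] on only cells right of [c] are read, so [x'] can be replaced by a tape that is
   periodic on both sides. *)
pose y (v : int) := x (c + ((v - c) %% d)%Z).
have yx' (v : int) : c <= v -> x' v = y v.
  move=> v_ge; rewrite /x' /y /= /fold; case: ifP => // v_lt.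
  by rewrite modz_small; [congr x; lia | lia].
have b_iter t l : (t0 <= t)%N -> iter l (S y) (b t) = b (l + t)%N.
  move=> t_ge; elim: l => //= l ->; have := b_far (l + t)%N (leq_trans t_ge (leq_addl _ _)).
  case: (b (l + t)%N) => v r /= v_gt.
  rewrite (walk_local wS (x := x') (u := v)); last by move=> i i_bd; apply: yx'; lia.
  by rewrite subrr /shift_point addr0 -surjective_pairing.
have [D dE] : exists D : nat, d = D.+1%:Z by exists (absz d).-1; lia.
(* Two times agree in state and in position modulo [d]; injectivity of [b] then makes the positions
   differ. *)
have [i [j [lt_ij _ [E1 E2]]]] := pigeonhole_nat (fun i =>
  (inord (absz ((b (t0 + i)%N).1 %% d)%Z) : 'I_D.+1, (b (t0 + i)%N).2)).
exists y, d, (b (t0 + i)%N), (b (t0 + j)%N), (j - i)%N; split=> //.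
- by move=> v; rewrite /y; congr (x (c + _)); rewrite addrAC modzDr.
- by rewrite b_iter ?leq_addr //; congr b; lia.
- split=> //; apply/eqP => E; have := b_inj (t0 + i)%N (t0 + j)%N.
  rewrite [b (t0 + i)%N]surjective_pairing [b (t0 + j)%N]surjective_pairing E E2.
  by move=> /(_ erefl); lia.
have E3 : ((b (t0 + i)%N).1 %% d = (b (t0 + j)%N).1 %% d)%Z.
  by have := congr1 val E1; rewrite /= !inordK; lia.
by rewrite -eqz_mod_dvd E3.
Qed.

(** * Iterated walks, reflection, and the dichotomy between torsion and drift *)

Lemma iter_move R S x a t : walk R S ->
  - (t * R)%N%:Z <= (iter t (S x) a).1 - a.1 <= (t * R)%N%:Z.
Proof.
move=> wS; elim: t => [|t IHt]; first by rewrite mul0n subrr.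
have := walk_move wS x (iter t (S x) a); rewrite mulSn /=; move: IHt.
by move: (S x _).1 (iter _ _ _).1 (t * R)%N => A B C; lia.
Qed.

Lemma iter_local R S x y u v q t : walk R S ->
  (forall i : int, - (t * R)%N%:Z <= i <= (t * R)%N%:Z -> x (u + i) = y (v + i)) ->
  iter t (S y) (v, q) = shift_point (iter t (S x) (u, q)) (v - u).
Proof.
move=> wS; elim: t => [|t IHt] xy /=.
  by rewrite /shift_point /= addrC subrK.
rewrite IHt => [|i i_bd]; last by apply: xy; move: i_bd; rewrite mulSn; lia.
have := iter_move x (u, q) t wS; case: (iter t (S x) _) => w r /= w_bd.
rewrite /shift_point /= (walk_local wS (x := x) (u := w)) => [|i i_bd].
  by rewrite /shift_point /=; congr (_ + _, _); lia.
have -> : w + i = u + (w - u + i) by lia.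
have -> : w + (v - u) + i = v + (w - u + i) by lia.
by apply: xy; move: w_bd; rewrite mulSn; move: (t * R)%N => B; lia.
Qed.

Lemma iter_shift R S x v q t : walk R S ->
  iter t (S x) (v, q) = shift_point (iter t (S (fun z => x (z + v))) (0, q)) v.
Proof.
move=> wS; rewrite (iter_local (x := fun z => x (z + v)) (u := 0) _ wS) ?subr0 //.
by move=> i _; rewrite add0r addrC.
Qed.

Lemma periodic_mul (T : Type) (x : int -> T) d : (forall v, x (v + d) = x v) ->
  forall c v, x (v + c * d) = x v.
Proof.
move=> xd; have xN i z : x (z + i%:Z * d) = x z.
  elim: i z => [|i IHi] z; first by rewrite mul0r addr0.
  by rewrite -(IHi z) -[RHS]xd; congr x; lia.
by case=> c v; rewrite ?xN // NegzE -(xN c.+1 (v + _)); congr x; lia.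
Qed.

(** Conjugation by the reflection of the line. It turns escape to the left into escape to the right,
    so that [pump_right] covers both directions. *)
Definition mirror S x (a : int * Q) :=
  let b := S (fun z => x (- z)) (- a.1, a.2) in (- b.1, b.2).

Lemma walk_mirror R S : walk R S -> walk R (mirror S).
Proof.
move=> wS; split=> [x y u v q xy | x a | x [u q] [v r]].
- rewrite /mirror /= (walk_local wS (x := fun z => x (- z)) (u := - u)) => [|i i_bd].
    by rewrite /shift_point /=; congr (_, _); lia.
  by rewrite !opprD !opprK xy //; lia.
- rewrite /mirror /=; have := walk_move wS (fun z => x (- z)) (- a.1, a.2).
  by move: (S _ _).1 => A /=; lia.
rewrite /mirror /= => -[/oppr_inj E1 E2].
have /(@walk_inj _ _ wS)[/oppr_inj -> ->//] :
  S (fun z => x (- z)) (- u, q) = S (fun z => x (- z)) (- v, r).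
by rewrite [LHS]surjective_pairing [RHS]surjective_pairing E1 E2.
Qed.

Lemma iter_mirror S x a t :
  iter t (mirror S x) a =
  let b := iter t (S (fun z => x (- z))) (- a.1, a.2) in (- b.1, b.2).
Proof.
elim: t => [|t /= ->]; first by rewrite /= opprK -surjective_pairing.
by rewrite /mirror /= opprK -surjective_pairing.
Qed.

Lemma drift_mirror S : has_drift (mirror S) -> has_drift S.
Proof.
move=> [x [d [a [b [t [d_gt0 xd ab [b2 b1] dvd]]]]]].
exists (fun z => x (- z)), d, (- a.1, a.2), (- b.1, b.2), t; split=> //=.
- by move=> v; rewrite -[LHS]xd; congr x; lia.
- by rewrite -ab iter_mirror /= opprK -surjective_pairing.
- by split=> //; rewrite (inj_eq oppr_inj).
- by rewrite (_ : - b.1 - - a.1 = - (b.1 - a.1)) ?rpredN //; lia.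
Qed.

(** An orbit stays in a set of [#|T|] points around its start, so its return time is at most [#|T|]
    and divides the factorial, which is an exponent common to all tapes. *)
Lemma bounded_torsion R S (N : nat) : walk R S ->
  (forall x q t, - N%:Z <= (iter t (S x) (0, q)).1 <= N%:Z) ->
  exists2 m, (0 < m)%N & forall x a, iter m (S x) a = a.
Proof.
move=> wS bound; pose T : finType := ('I_N.*2.+1 * Q)%type.
exists (#|T|)`!; first exact: fact_gt0.
move=> x [v q].
have near t : - N%:Z <= (iter t (S x) (v, q)).1 - v <= N%:Z.
  by rewrite (iter_shift _ _ _ _ wS) addrK.
have [i [j [lt_ij le_j [E1 E2]]]] := pigeonhole_nat (fun t =>
  (inord (absz ((iter t (S x) (v, q)).1 - v + N%:Z)%R) : 'I_N.*2.+1,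
   (iter t (S x) (v, q)).2)).
have E : iter i (S x) (v, q) = iter j (S x) (v, q).
  rewrite [LHS]surjective_pairing [RHS]surjective_pairing E2; congr (_, _).
  move: (congr1 val E1) (near i) (near j) => /=.
  by move: (iter i _ _).1 (iter j _ _).1 => A B AB A_bd B_bd; rewrite !inordK in AB; lia.
have per := iter_inj_eq (@walk_inj _ _ wS x) (ltnW lt_ij) E.
have /dvdnP[c ->] : (j - i %| (#|T|)`!)%N.
  by rewrite dvdn_fact // subn_gt0 lt_ij (leq_trans (leq_subr _ _)).
by rewrite mulnC; elim: c => [|c IHc]; rewrite ?muln0 // mulnS iterD IHc.
Qed.

(** Without drift, [pump_right] applied to [S] and to its mirror image bounds all displacements. *)
Lemma torsion_or_drift R S : walk R S ->
  (exists2 m, (0 < m)%N & forall x a, iter m (S x) a = a) \/ has_drift S.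
Proof.
move=> wS; have [|no_drift] := pselect (has_drift S); [by right | left].
have right_bound S' : walk R S' -> ~ has_drift S' ->
    exists N : nat, forall x q t, (iter t (S' x) (0, q)).1 <= N%:Z.
  move=> wS' no_drift'; apply: contrapT => far; apply/no_drift'/(pump_right wS') => N.
  apply: contrapT => near; apply: far; exists N => x q t; rewrite leNgt.
  by apply/negP => gt; apply: near; exists x, q, t.
have [N1 N1P] := right_bound S wS no_drift.
have [N2 N2P] := right_bound _ (walk_mirror wS) (no_drift \o @drift_mirror S).
apply: (@bounded_torsion R S (maxn N1 N2) wS) => x q t.
have := N1P x q t; have := N2P (fun z => x (- z)) q t; rewrite iter_mirror /= oppr0.
rewrite (_ : (fun z => _) = x); last by apply: funext => z; rewrite opprK.
by move: (iter _ _ _).1 => A; lia.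
Qed.

(** By periodicity the tape looks the same from the end of the drift as from its start, so the
    displacement adds up at each repetition, and after [m] repetitions it is still nonzero. *)
Lemma drift_not_torsion R S m : walk R S -> (0 < m)%N ->
  (forall x a, iter m (S x) a = a) -> ~ has_drift S.
Proof.
move=> wS m_gt0 tors [x [d [[u q] [[v r] [t [_ xd ab /= [E ne] /dvdzP[c vE]]]]]]].
rewrite {r}E in ab; have x_per := periodic_mul xd.
have walkE l : iter (l * t) (S x) (u, q) = (u + l%:Z * (v - u), q).
  elim: l => [|l IHl]; first by rewrite mul0n mul0r addr0.
  rewrite mulSn iterD IHl (iter_local (x := x) (u := u) _ wS) => [|i _].
    by rewrite ab /shift_point /=; congr (_, _); lia.
  by rewrite vE -(x_per (l%:Z * c) (u + i)); congr x; lia.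
have : iter (m * t) (S x) (u, q) = (u, q).
  by rewrite mulnC; elim: t {ab walkE} => // t IHt; rewrite mulSn iterD IHt.
by rewrite walkE => -[]; nia.
Qed.

End Walks.

(** * Machines and their presentations *)

Section Machines.

Import GRing.Theory Num.Theory Order.TTheory.
Local Open Scope ring_scope.

Variables n k : nat.

Definition head_at (a : int * state k) : head_shift k :=
  exist _ (single_head a.1 a.2) (single_headP a.1 a.2).

(** The map S_x on heads. Dropping the written pattern is justified by [RFA_head]. *)
Definition head_step F F' (f : local_rule n k F F') (x : int -> 'I_n)
    (a : int * state k) : int * state k :=
  let r := f ([ffun u : F => x (a.1 + val u)], a.2) in (a.1 + r.2, r.1.2).

Lemma head_inj : injective head_at.
Proof.
move=> [u q] [v r] /(congr1 sval)/= E.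
have Eu := congr1 (@^~ u) E; rewrite /single_head eqxx in Eu.
have uv : u = v by case: eqP Eu => // _ Eq; have := valP q; rewrite /= Eq.
by move: Eu; rewrite uv eqxx => /val_inj ->.
Qed.

Lemma head_surj (y : head_shift k) v : sval y v != ord0 -> exists a, y = head_at a.
Proof.
case: y => y yP /= yv; exists (v, Sub (y v) yv); apply: eq_exist; apply: funext => u.
rewrite /single_head /=; case: eqP => [-> //|ne]; apply/eqP/negPn/negP => yu.
exact: ne (yP _ _ yu yv).
Qed.

Lemma TM_map_head F F' (f : local_rule n k F F') x a :
  (TM_map f (x, head_at a)).2 = head_at (head_step f x a).
Proof.
case: a => u q; rewrite /TM_map /=; case: pselect => [ex|[]]; last first.
  by exists u; rewrite /single_head eqxx (valP q).
case: cid => v yv; have /eqP vu : v == u.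
  by apply: contraNT yv => ne; rewrite /= /single_head (negbTE ne).
subst v; set q' := Sub _ _; have -> : q' = q.
  by apply: val_inj; rewrite SubK /single_head eqxx.
by rewrite /head_at /head_step /=; case: (f _) => [[p' q1] e].
Qed.

Lemma TM_map_tape F (f : local_rule n k F F) x y :
  tape_preserving f -> (TM_map f (x, y)).1 = x.
Proof.
move=> fP; rewrite /TM_map /=; case: pselect => // ex; case: cid => v yv.
move: (fP [ffun u : F => x (v + val u)] (Sub (sval y v) yv)).
case: (f _) => [[p' q1] e] /= ->; apply: funext => t.
by case: insubP => // u _ uE; rewrite ffunE uE addrC subrK.
Qed.

Lemma TM_map_no_head F F' (f : local_rule n k F F') c :
  ~ (exists v, sval c.2 v != ord0) -> TM_map f c = c.
Proof. by move=> no; rewrite /TM_map; case: pselect. Qed.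

Section OneMachine.

Variables (T : config n k -> config n k) (F F' : {fset int}).
Variable f : local_rule n k F F'.
Hypotheses (T_RFA : RFA T) (T_f : T =1 TM_map f).

(** The head is computed with the given rule [f], which may have different supports; that the tape
    is kept comes from another, tape-preserving rule of the same map. *)
Lemma RFA_head x a : T (x, head_at a) = (x, head_at (head_step f x a)).
Proof.
rewrite [LHS]surjective_pairing {2}T_f TM_map_head; congr (_, _).
by case: T_RFA => _ [F0 [f0 [f0P ->]]]; apply: TM_map_tape.
Qed.

Lemma iter_RFA_head m x a : iter m T (x, head_at a) = (x, head_at (iter m (head_step f x) a)).
Proof. by elim: m => //= m ->; apply: RFA_head. Qed.

Lemma head_step_inj x : injective (head_step f x).
Proof.
case: T_RFA => -[_ [T' _ [TK _]]] _ a b E; apply: head_inj.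
have /(can_inj TK) : T (x, head_at a) = T (x, head_at b) by rewrite !RFA_head E.
by move/(congr1 snd).
Qed.

(** Configurations without a head are fixed, so only the action on heads matters. *)
Lemma torsionE : torsion T <->
  exists2 m, (0 < m)%N & forall x a, iter m (head_step f x) a = a.
Proof.
split=> -[m m_gt0 mP]; exists m => //.
  by move=> x a; apply: head_inj; move: (mP (x, head_at a)); rewrite iter_RFA_head => /(congr1 snd).
move=> [x y]; have [[v /head_surj[a ->]]|no] := pselect (exists v, sval y v != ord0).
  by rewrite iter_RFA_head mP.
by elim: (m) => //= j ->; rewrite T_f TM_map_no_head.
Qed.

Lemma head_step_walk R :
  (forall u : F, - R%:Z <= val u <= R%:Z) -> (forall pq, - R%:Z <= (f pq).2 <= R%:Z) ->
  walk R (head_step f).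
Proof.
move=> F_bd f_bd; split=> [x y u v q xy | x a | ]; last exact: head_step_inj.
  rewrite /head_step /=.
  have -> : [ffun w : F => y (v + val w)] = [ffun w : F => x (u + val w)].
    by apply/ffunP => w; rewrite !ffunE xy.
  by rewrite /shift_point /=; congr (_, _); lia.
by rewrite /head_step /= addrC addKr.
Qed.

End OneMachine.

End Machines.

(** * Reading a rule off its code *)

Lemma size_code s : size s <= CodeSeq.code s.
Proof.
elim: s => //= x s IHs; rewrite (leq_trans _ (leq_pmull _ (expn_gt0 2 x))) //.
by rewrite ltnS -addnn (leq_trans IHs) ?leq_addr.
Qed.

Lemma nth_flatten_const (A : Type) (x0 : A) (rows : seq (seq A)) c r j :
  all (fun row => size row == c) rows -> j < c ->
  nth x0 (flatten rows) (r * c + j) = nth x0 (nth [::] rows r) j.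
Proof.
move=> + lt_j; elim: rows r => [|row rows IHr] [|r] /=; rewrite ?nth_nil //.
  by move=> /andP[/eqP szr _]; rewrite nth_cat szr lt_j.
move=> /andP[/eqP szr all_c]; rewrite nth_cat szr mulSn -addnA ltnNge leq_addr /=.
by rewrite addKn IHr.
Qed.

Lemma digits_exist n L (g : nat -> 'I_n) :
  exists2 t, t < n ^ L & forall i, i < L -> digit n t i = g i.
Proof.
have n_gt0 : 0 < n by apply: leq_ltn_trans (ltn_ord (g 0)).
elim: L g => [|L IHL] g; first by exists 0; rewrite ?expn0.
have [t t_lt tP] := IHL (g \o S); exists (t * n + g 0) => [|[_|i lt_i]].
- rewrite expnSr (@leq_trans (t.+1 * n)) ?leq_mul2r ?t_lt ?orbT //.
  by rewrite mulSn addnC ltn_add2r.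
- by rewrite /digit expn0 divn1 modnMDl modn_small.
by rewrite /digit expnS divnMA divnMDl // (divn_small (ltn_ord (g 0))) addn0 -/(digit n t i) tP.
Qed.

Section Presentation.

Import GRing.Theory Num.Theory Order.TTheory.

Variables n k : nat.
Variables (F F' : {fset int}) (f : local_rule n k F F') (w : nat).
Variables (s : seq F) (s' : seq F') (args : seq (pattern n F * state k)).
Hypotheses (s_enum : perm_eq s (enum {: F})).
Hypothesis args_enum : perm_eq args (enum {: pattern n F * state k}).
Hypothesis wE : w = code_rule f s s' args.

Let table := [seq code_table_row f s s' pq | pq <- args].

Let entries :=
  size s :: [seq code_int (val u) | u <- s] ++
  size s' :: [seq code_int (val u) | u <- s'] ++ flatten table.

Let w_entries : w = CodeSeq.code entries. Proof. by []. Qed.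

Lemma code_nth_entries i : code_nth w i = nth 0 entries i.
Proof. by rewrite w_entries code_nthE. Qed.

Lemma code_nth_size : code_nth w 0 = size s.
Proof. by rewrite code_nth_entries. Qed.

Lemma code_nth_support u0 j : j < size s ->
  code_nth w j.+1 = code_int (val (nth u0 s j)).
Proof.
by move=> lt_j; rewrite code_nth_entries /= nth_cat size_map lt_j (nth_map u0).
Qed.

Lemma out_offsetE : out_offset w = size s + size s' + 1.
Proof.
rewrite /out_offset code_nth_size code_nth_entries /= nth_cat size_map.
by rewrite ltnn subnn.
Qed.

Lemma code_nth_row r j : j < size s + size s' + 3 ->
  code_nth w (row_offset w r + j) = nth 0 (nth [::] table r) j.
Proof.
move=> lt_j; rewrite -(@nth_flatten_const _ 0 table (size s + size s' + 3)) //; last first.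
  rewrite all_map; apply/allP => -[p q] _; rewrite /= /code_table_row; case: (f _) => [[p' q'] e].
  by rewrite size_cat /= size_cat !size_map /=; lia.
rewrite /row_offset out_offsetE code_nth_entries /entries.
rewrite -cat1s -[size s' :: _]cat1s !catA nth_cat !size_cat !size_map /=.
by rewrite ifF; [congr nth|]; nia.
Qed.

Lemma code_nth_rowE r pq0 : r < size args ->
  let pq := nth pq0 args r in
  [/\ forall u0 j, j < size s -> code_nth w (row_offset w r + j) = pq.1 (nth u0 s j),
      code_nth w (row_offset w r + size s) = val (val pq.2),
      code_nth w (row_offset w r + out_offset w) = val (val (f pq).1.2)
    & code_nth w (row_offset w r + (out_offset w).+1) = code_int (f pq).2].
Proof.
move=> lt_r /=; rewrite out_offsetE.
have rowE : nth [::] table r = code_table_row f s s' (nth pq0 args r).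
  by rewrite (nth_map pq0).
move: rowE; case: (nth pq0 args r) => p q; rewrite /code_table_row; case: (f _) => [[p' q'] e] rowE.
split=> [u0 j lt_j| | |].
- rewrite code_nth_row ?rowE; last by lia.
  by rewrite nth_cat size_map lt_j (nth_map u0).
- rewrite code_nth_row ?rowE; last by lia.
  by rewrite nth_cat size_map ltnn subnn.
- rewrite code_nth_row ?rowE; last by lia.
  rewrite nth_cat size_map -addnA ltnNge leq_addr addKn /=.
  by rewrite addn1 /= nth_cat size_map ltnn subnn.
- rewrite code_nth_row ?rowE; last by lia.
  rewrite addn1 -!addnS nth_cat size_map ltnNge leq_addr addKn /=.
  by rewrite nth_cat size_map ltnNge leqnSn /= subSnn.
Qed.

Lemma mem_entries i : i \in entries -> i < w.
Proof. by rewrite w_entries; apply: (allP (CodeSeq.ltn_code entries)). Qed.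

(** No row is empty, so there are at most as many rows as entries, and a list is no longer than its
    code. *)
Lemma size_args_le : size args <= w.
Proof.
rewrite w_entries; apply: leq_trans (size_code entries); rewrite /= !size_cat /= size_cat.
have : size args <= size (flatten table).
  2: by move: (size args) (size (flatten _)) => A B; lia.
rewrite /table; elim: (args) => //= -[p q] a IHa; rewrite size_cat -add1n leq_add //.
by rewrite /code_table_row; case: (f _) => [[p' q'] e]; rewrite size_cat addnS.
Qed.

Local Open Scope ring_scope.

(** Every entry of a list is smaller than its code. With the next bound, this lets the number [w]
    itself serve as a radius of the machine that it presents. *)
Lemma support_le_code (u : F) : - w%:Z <= val u <= w%:Z.
Proof.
have : (code_int (val u) < w)%N.
  apply: mem_entries; rewrite inE mem_cat; apply/orP/or_intror/orP/or_introl.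
  by apply: map_f; rewrite (perm_mem s_enum) mem_enum.
by case: (val u) => m /=; lia.
Qed.

Lemma displacement_le_code pq : - w%:Z <= (f pq).2 <= w%:Z.
Proof.
have : (code_int (f pq).2 < w)%N.
  have pq_args : pq \in args by rewrite (perm_mem args_enum) mem_enum.
  have := @code_nth_rowE (index pq args) pq; rewrite index_mem nth_index //.
  case=> // _ _ _ <-; rewrite code_nth_entries; set i := (_ + _)%N.
  (* Past the end the default 0 would be read, which is below [w] as well. *)
  have [lt|ge] := ltnP i (size entries); first by apply: mem_entries; rewrite mem_nth.
  by rewrite nth_default // (leq_ltn_trans _ (mem_entries (mem_head _ _))).
by case: ((f pq).2) => m /=; lia.
Qed.

Lemma move_byE p (z : int) : (absz z <= p)%N -> (move_by p (code_int z))%:Z = p%:Z + z.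
Proof.
case: z => m /= le_mp; rewrite /move_by /= ?odd_double /= ?uphalf_double ?doubleK; lia.
Qed.

Definition periodic_tape (n_gt0 : (0 < n)%N) t d (z : int) : 'I_n :=
  Ordinal (ltn_pmod (t %/ n ^ absz (z %% d%:Z)%Z)%N n_gt0).

Definition point_code (a : int * state k) := (absz a.1 * k.+1 + val (val a.2))%N.

Hypothesis n_gt0 : (0 < n)%N.

(** The bound on [p] makes every cell of the window reachable by exact subtraction. The row of the
    true arguments matches, so the first match is no later, hence inside the table, where a match
    means equality of the arguments. *)
Lemma row_correct t d p (q : state k) : (w <= p)%N ->
  exists2 r, (r < size args)%N /\
     matching_row n w t d p (val (val q)) = row_offset w r &
     forall pq0, nth pq0 args r =
       ([ffun u : F => periodic_tape n_gt0 t d (p%:Z + val u)], q).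
Proof.
move=> le_wp; pose pq : pattern n F * state k :=
  ([ffun u : F => periodic_tape n_gt0 t d (p%:Z + val u)], q).
have pq_args : pq \in args by rewrite (perm_mem args_enum) mem_enum.
have digitE (u : F) : digit n t (move_by p (code_int (val u)) %% d) =
    periodic_tape n_gt0 t d (p%:Z + val u).
  rewrite /= /digit -move_byE ?modz_nat //.
  by have := support_le_code u => /=; lia.
have sP (u : F) : u \in s by rewrite (perm_mem s_enum) mem_enum.
have matchE r : (r < size args)%N ->
    row_match n w t d p (val (val q)) r = (nth pq args r == pq).
  move=> lt_r; have [patE stE _ _] := code_nth_rowE pq lt_r.
  rewrite /row_match code_nth_size stE; apply/idP/eqP; last first.
    move=> argE; rewrite argE eqxx andbT; apply/allP => j; rewrite mem_iota /= => lt_j.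
    have u0 : F by case: (s) lt_j => // u.
    by rewrite (patE u0) // (code_nth_support u0) // argE ffunE digitE.
  case/andP=> /allP patP /eqP stP; rewrite [LHS]surjective_pairing; congr (_, _).
    apply/ffunP => u; rewrite ffunE; apply: val_inj.
    have lt_u : (index u s < size s)%N by rewrite index_mem.
    have := patP (index u s); rewrite mem_iota => /(_ lt_u).
    by rewrite (patE u) // (code_nth_support u) // nth_index // digitE => /eqP.
  by do 2![apply: val_inj].
pose r0 := index pq args; have lt_r0 : (r0 < size args)%N by rewrite index_mem.
set a := row_match n w t d p (val (val q)) in matchE.
have has_r : has a (iota 0 w).
  apply/hasP; exists r0; rewrite ?matchE ?nth_index //.
  by rewrite mem_iota (leq_trans lt_r0 size_args_le).
have lt_r : (find a (iota 0 w) <= r0)%N.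
  rewrite leqNgt; apply/negP => /[dup] lt /(before_find 0).
  rewrite nth_iota ?matchE ?nth_index ?eqxx //.
  exact: leq_trans lt_r0 size_args_le.
have lt_args := leq_ltn_trans lt_r lt_r0.
exists (find a (iota 0 w)) => // pq0; apply/eqP.
rewrite (set_nth_default pq) // -/pq -matchE //.
have := nth_find 0 has_r; rewrite nth_iota //.
by apply: leq_trans lt_args size_args_le.
Qed.

Lemma step_correct t d p (q : state k) : (w <= p)%N ->
  step n k w t d (point_code (p%:Z, q)) =
  point_code (head_step f (periodic_tape n_gt0 t d) (p%:Z, q)).
Proof.
move=> le_wp; rewrite /step /point_code /=.
have lt_q : (val (val q) < k.+1)%N by apply: ltn_ord.
rewrite divnMDl // modnMDl divn_small // modn_small // addn0.
have [r [lt_r ->] /(_ ([ffun=> Ordinal n_gt0], q)) argE] := row_correct t d q le_wp.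
have [_ _] := code_nth_rowE ([ffun=> Ordinal n_gt0], q) lt_r; rewrite argE => -> ->.
congr (_ * _ + _)%N; set pq := (_, q).
have bd := displacement_le_code pq; rewrite -[LHS]absz_nat move_byE //; lia.
Qed.

(** Each step moves by at most [w], so a start at [m.+1 * w] or beyond leaves the position at least
    [w] whenever a step is simulated. *)
Lemma run_correct t d m p (q : state k) : walk w (head_step f) -> (m.+1 * w <= p)%N ->
  run n k w t d m (point_code (p%:Z, q)) =
  point_code (iter m (head_step f (periodic_tape n_gt0 t d)) (p%:Z, q)).
Proof.
move=> wf; elim: m => // m IHm le_p; rewrite /run iterS -/(run _ _ _ _ _ _ _) IHm; last first.
  by move: le_p; rewrite mulSn; lia.
have := iter_move (periodic_tape n_gt0 t d) (p%:Z, q) m wf.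
case E : (iter m _ _) => [v r] /= v_bd; rewrite E.
have v_ge : w%:Z <= v by move: le_p v_bd; rewrite !mulSn; move: (m * w)%N => B; lia.
by have -> : v = (absz v)%:Z by [lia]; apply: step_correct; lia.
Qed.

End Presentation.

(** * The decision procedure *)

(** [Mu] requires the test to be defined and nonzero before the value found; this holds because
    [test] is total and the least zero is taken. *)
Lemma computable_search (test out : nat -> nat -> nat) :
  computable 2 (fun e => test (e 0) (e 1)) -> computable 2 (fun e => out (e 0) (e 1)) ->
  exists A : recfun 1, forall w, (exists m, test m w = 0) ->
    exists2 m, test m w = 0 & computes A [tuple w] (out m w).
Proof.
move=> [c cP] [o oP].
pose args (i : 'I_2) : recfun 1 := if i == ord0 then Mu c else Proj ord0.
exists (Comp o args) => w test0.
have ex0 : exists m, test m w == 0 by case: test0 => m /eqP; exists m.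
have [m /eqP m0 m_min] := ex_minnP ex0; exists m => //.
exists [tuple m; w]; last exact: oP [tuple m; w].
case=> [[|[|//]] i_lt]; rewrite (tnth_nth 0) //=.
split=> [|i lt_im]; first by have := cP [tuple m; w]; rewrite /= m0.
exists (test i w).-1; rewrite prednK; first exact: cP [tuple i; w].
by rewrite lt0n; apply: contraL lt_im => /m_min; rewrite -leqNgt.
Qed.

Section Decision.

Import GRing.Theory Num.Theory Order.TTheory.
Local Open Scope ring_scope.

Variables n k : nat.
Variables (F F' : {fset int}) (f : local_rule n k F F') (w : nat).
Hypotheses (w_f : presents w f) (wf : walk w (head_step f)) (n_gt0 : (0 < n)%N).

Let tape := periodic_tape n_gt0.

Lemma presented_run t d m p (q : state k) : (m.+1 * w <= p)%N ->
  run n k w t d m (point_code (p%:Z, q)) =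
  point_code (iter m (head_step f (tape t d)) (p%:Z, q)).
Proof. by case: w_f => s [s' [args [s_en _ args_en wE]]]; apply: (run_correct s_en args_en wE). Qed.

Lemma point_code_inj (p : nat) q (a : int * state k) : 0 <= a.1 ->
  point_code a = point_code (p%:Z, q) -> a = (p%:Z, q).
Proof.
case: a => v r /= v_ge E.
have lt_q (q' : state k) : (val (val q') < k.+1)%N by apply: ltn_ord.
have := congr1 (divn^~ k.+1) E; have := congr1 (modn^~ k.+1) E.
rewrite /point_code /= !modnMDl !divnMDl // !divn_small // !modn_small // !addn0.
by move=> /val_inj/val_inj -> vp; congr (_, _); lia.
Qed.

Definition nat_state i (lt_i : (i.+1 < k.+1)%N) : state k := Sub (Ordinal lt_i) isT.

Lemma state_nat (q : state k) : exists2 i, (i < k)%N & val (val q) = i.+1 :> nat.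
Proof.
case: q => -[[|i] lt_i] //= _.
by exists i.
Qed.

Lemma tape_exists (x : int -> 'I_n) u L :
  exists2 t, (t < n ^ L)%N & forall i d : nat, (i %% d < L)%N ->
    tape t d i%:Z = x (u + (i %% d)%N%:Z).
Proof.
have [t t_lt tP] := @digits_exist n L (fun i => x (u + i%:Z)).
by exists t => // i d lt_i; apply: val_inj; rewrite /= modz_nat -tP.
Qed.

Lemma loopsP m : loops n k w m <-> forall x a, iter m (head_step f x) a = a.
Proof.
pose L := (m.+1 * w)%N; pose p := (L.*2.+1 + L)%N.
have le_p : (m.+1 * w <= p)%N by rewrite /p /L leq_addl.
split=> [/allP loop x [v q]|tors]; last first.
  apply/allP => t _; apply/allP => i; rewrite mem_iota /= -ltnS => lt_i.
  rewrite /loops_from -/L -/p; have := presented_run t L.*2.+1 (nat_state lt_i) le_p.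
  by rewrite tors => ->.
(* The copied window starts at [v - L], so [v] lands on residue [L], which is the residue of [p]
   modulo the period. *)
have [t lt_t tP] := tape_exists x (v - L%:Z) L.*2.+1.
have [i lt_i qE] := state_nat q.
have := loop t; rewrite mem_iota => /(_ lt_t)/allP/(_ i); rewrite mem_iota => /(_ lt_i).
rewrite /loops_from -/L -/p -qE -[(_ * _ + _)%N]/(point_code (p%:Z, q)).
rewrite presented_run // => /eqP/point_code_inj iter_p.
have -> : iter m (head_step f x) (v, q) =
    shift_point (iter m (head_step f (tape t L.*2.+1)) (p%:Z, q)) (v - p%:Z).
  apply: (iter_local _ wf) => j j_bd.
  have j_le : (m * w <= L)%N by rewrite /L mulSn leq_addl.
  have j_bd' : - L%:Z <= j <= L%:Z by move: (m * w)%N j_le j_bd => B; lia.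
  have [j' pj] : exists j' : nat, p%:Z + j = (L.*2.+1 + j')%N%:Z /\ (j' < L.*2.+1)%N.
    by exists (absz (j + L%:Z)%R); rewrite /p; lia.
  case: pj => pj lt_j'; rewrite pj tP modnDl modn_small //; congr x.
  by move: pj; rewrite /p; lia.
rewrite iter_p ?/shift_point /=; first by congr (_, _); lia.
have := iter_move (tape t L.*2.+1) (p%:Z, q) m wf.
by move: (iter _ _ _).1 => A /=; rewrite /p /L mulSn; move: (m * w)%N => B; lia.
Qed.

Lemma driftsP : (exists m, drifts n k w m) <-> has_drift (head_step f).
Proof.
split=> [[m /hasP[t _ /hasP[D _ /hasP[s _ /hasP[i]]]]]|].
  rewrite mem_iota /= -ltnS => lt_i; set p := (D.+1 * _)%N.
  have le_p : (s.+1 * w <= p)%N by rewrite leq_pmull.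
  have := presented_run t D.+1 (nat_state lt_i) le_p.
  rewrite /drifts_from -/(point_code (p%:Z, nat_state lt_i)) => ->.
  have := iter_move (tape t D.+1) (p%:Z, nat_state lt_i) s wf.
  case E : (iter _ _ _) => [v r] /= v_bd.
  have v_ge : 0 <= v by move: le_p v_bd; rewrite mulSn; move: (s * w)%N => B; lia.
  rewrite /point_code /= modnMDl divnMDl // divn_small ?modn_small ?ltn_ord // addn0.
  case/and3P=> /eqP rE dvd ne.
  exists (tape t D.+1), D.+1%:Z, (p%:Z, nat_state lt_i), (v, r), s; split=> //=.
  - by move=> z; apply: val_inj; rewrite /= modzDr.
  - by split; [do 2!apply: val_inj | apply: contraNneq ne => ->].
  by rewrite rpredB // dvdzE /= dvdn_mulr.
move=> [x [d [[u q] [[v r] [s [d_gt0 xd ab /= [rE ne] dvd]]]]]]; rewrite {r}rE in ab.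
case: d d_gt0 xd dvd => // -[//|D] _ xd dvd.
have [t t_lt tP] := tape_exists x u D.+1.
have [i lt_i qE] := state_nat q.
pose m := (maxn t (maxn D s)).+1; exists m.
have lt_m j : (j <= m.-1)%N -> j \in iota 0 m by rewrite mem_iota.
apply/hasP; exists t; first by apply: lt_m; rewrite leq_maxl.
apply/hasP; exists D; first by apply: lt_m; rewrite leq_max leq_maxl orbT.
apply/hasP; exists s; first by apply: lt_m; rewrite !leq_max leqnn !orbT.
apply/hasP; exists i; first by rewrite mem_iota.
pose p := (D.+1 * (s.+1 * w))%N; rewrite /drifts_from -/p.
have le_p : (s.+1 * w <= p)%N by rewrite leq_pmull.
(* The stored period starts at [u]; as [p] is a multiple of [D.+1], the surroundings of [p] on the
   stored tape are those of [u] on [x]. *)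
have tapeE z : tape t D.+1 z = x (u + z).
  have [z' zE] : exists z' : nat, (z %% D.+1%:Z)%Z = z' by exists (absz (z %% D.+1%:Z)%Z); lia.
  rewrite [in RHS](divz_eq z D.+1%:Z) addrCA addrC (periodic_mul xd) zE.
  have -> : tape t D.+1 z = tape t D.+1 z'%:Z by apply: val_inj; rewrite /= -zE modz_mod.
  by rewrite tP modn_small //; lia.
have runE : iter s (head_step f (tape t D.+1)) (p%:Z, q) = (v + (p%:Z - u), q).
  rewrite (iter_local (x := x) (u := u) _ wf) ?ab // => j _.
  have /dvdzP[c pE] : (D.+1%:Z %| p%:Z)%Z by rewrite dvdzE dvdn_mulr.
  by rewrite tapeE pE -(periodic_mul xd c (u + j)); congr x; lia.
have := presented_run t D.+1 q le_p; rewrite runE /point_code /= qE => ->.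
have := iter_move (tape t D.+1) (p%:Z, q) s wf; rewrite runE /= => v_bd.
have v_ge : 0 <= v + (p%:Z - u).
  by move: le_p v_bd; rewrite mulSn; move: (s * w)%N => B; lia.
rewrite modnMDl divnMDl // divn_small ?modn_small ?ltnS // addn0 eqxx /=.
apply/andP; split; last by apply: contraNneq ne => E; apply/eqP; lia.
have -> : v + (p%:Z - u) = (v - u) + p%:Z by lia.
have : (D.+1%:Z %| v - u + p%:Z)%Z by rewrite rpredD // dvdzE dvdn_mulr.
by rewrite dvdzE.
Qed.

End Decision.

Theorem theorem7 (n k : nat) (hn : (1 <= n)%N) (hk : (1 <= k)%N) :
  exists A : recfun 1,
    forall T : config n k -> config n k, RFA T ->
    forall (F F' : {fset int}) (f : local_rule n k F F'), T =1 TM_map f ->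
    forall w : nat, presents w f ->
      (torsion T -> computes A [tuple w] 1) /\
      (~ torsion T -> computes A [tuple w] 0).
Proof.
(* The exponent is the successor of the search variable, hence positive. *)
have c_loops : computable 2 (fun e => loops n k (e 1) (e 0).+1 : nat).
  exact: computable_loops (computable_var _ _) (computable_S (computable_var _ _)).
have c_drifts : computable 2 (fun e => drifts n k (e 1) (e 0) : nat).
  exact: computable_drifts (computable_var _ _) (computable_var _ _).
(* The test vanishes as soon as either certificate appears, and the output tells whether an exponent
   was found. *)
have [A AP] := @computable_search
  (fun m w => ~~ (loops n k w m.+1 || drifts n k w m)) (fun m w => loops n k w m.+1)
  (computable_neg (computable_or c_loops c_drifts)) c_loops.
exists A => T T_RFA F F' f T_f w w_f.
have wf : walk w (head_step f).
  case: (w_f) => s [s' [args [s_en _ args_en wE]]].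
  apply: (head_step_walk T_RFA T_f) => [u|pq].
    exact: support_le_code s_en args_en wE u.
  exact: displacement_le_code s_en args_en wE pq.
have loops_tors m : loops n k w m.+1 -> torsion T.
  by move=> /(loopsP w_f wf hn)h; apply/(torsionE T_RFA T_f); exists m.+1.
have drifts_ntors m : drifts n k w m -> ~ torsion T.
  move=> dr /(torsionE T_RFA T_f)[l l_gt0 /(drift_not_torsion wf l_gt0)]; apply.
  by apply/(driftsP w_f wf hn); exists m.
(* The search halts: torsion supplies an exponent, and otherwise the dichotomy supplies a drift. *)
have [|m] := AP w.
  have [/(torsionE T_RFA T_f)[[//|m] _ /(loopsP w_f wf hn) lo]|] := pselect (torsion T).
    by exists m; rewrite lo.
  move=> ntors; have [tors|/(driftsP w_f wf hn)[m dr]] := torsion_or_drift wf.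
    by case: ntors; apply/(torsionE T_RFA T_f).
  by exists m; rewrite dr orbT.
(* Both certificates are sound, so the output is right; if no exponent is seen at [m], the search
   stopped on a drift. *)
case: (boolP (loops n k w m.+1)) => [/loops_tors tors _ cA|_ /=].
  by split=> // ntors; case: (ntors tors).
by case: (boolP (drifts n k w m)) => // /drifts_ntors ntors _ cA; split.
Qed.
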